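(* Let $G$ and $H$ be discrete groups, let $p,q>0$, and let $E\subset G$, $F\subset H$ be subsets such that $\|\lambda_G(f)\|\le p\,\|f\|_2$ for all $f\in\mathbb C[G]$ with $\mathrm{supp}(f)\subseteq E$, and $\|\lambda_H(f')\|\le q\,\|f'\|_2$ for all $f'\in\mathbb C[H]$ with $\mathrm{supp}(f')\subseteq F$. Then $\|\lambda_{G\times H}(\varphi)\|\le pq\,\|\varphi\|_2$ for all $\varphi\in\mathbb C[G\times H]$ with $\mathrm{supp}(\varphi)\subseteq E\times F$.
   Context: For a discrete group $G$, $\mathbb C[G]$ is the space of finitely supported functions $G\to\mathbb C$, and $\|f\|_2$ is the $\ell^2(G)$-norm. For $f\in\mathbb C[G]$, $\lambda_G(f)$ is the bounded operator on $\ell^2(G)$ given by convolution: $\lambda_G(f)\omega=f*\omega$, $(f*\omega)(g)=\sum_{h\in G}f(h)\omega(h^{-1}g)$; $\|\lambda_G(f)\|$ is its operator norm. *)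

(* Defs.v *)
From HB Require Import structures.
From mathcomp Require Import all_boot all_order all_algebra finmap.
From mathcomp Require Import complex.
From mathcomp Require Import boolp classical_sets functions cardinality.
From mathcomp Require Import fsbigop reals ereal esum.

Set Implicit Arguments.
Unset Strict Implicit.
Unset Printing Implicit Defensive.

Import Order.TTheory GRing.Theory Num.Theory.

Local Open Scope classical_set_scope.
Local Open Scope ring_scope.

(* The group algebra C[G]; the complex numbers are R[i] for R : realType. *)
Definition group_alg (R : realType) (G : groupType) :=
  {fsfun G -> R[i] with 0}.

Definition supp (R : realType) (G : groupType) (f : group_alg R G) : set G :=
  [set x | x \in finsupp f].

(* Extended-real valued: it is +oo exactly when w is not square-summable. *)
Definition l2norm (R : realType) (X : choiceType) (w : X -> R[i]) : \bar R :=
  sqrte (\esum_(x in [set: X]) ((Normc.normc (w x)) ^+ 2)%:E).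

Definition l2 (R : realType) (X : choiceType) : set (X -> R[i]) :=
  [set w | (l2norm w < +oo)%E].

(* The left regular representation: convolution by f. *)
Definition lambda (R : realType) (G : groupType) (f : group_alg R G)
    (w : G -> R[i]) : G -> R[i] :=
  fun g => \sum_(h <- finsupp f) f h * w (h^-1 * g)%g.

(* The operator norm on l2 X, a supremum in the extended reals, so that it is
   +oo when T is unbounded and no boundedness is assumed beforehand. *)
Definition opnorm (R : realType) (X : choiceType)
    (T : (X -> R[i]) -> (X -> R[i])) : \bar R :=
  ereal_sup [set l2norm (T w) | w in [set w | l2 w /\ (l2norm w <= 1)%E]].

(* Main.v *)
Require Import Defs.
From HB Require Import structures.
From mathcomp Require Import all_boot all_order all_algebra finmap.
From mathcomp Require Import complex.
From mathcomp Require Import boolp classical_sets functions cardinality.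
From mathcomp Require Import fsbigop reals ereal esum.
From mathcomp Require Import ring.

(** Slice along G: for phi supported in E x F and w in l2(G x H), the slice of
    phi * w at g is the finite sum over a of phi(a, .) * w(a^-1 g, .), so
    Minkowski's inequality and the bound on F give
      |(phi * w)(g, .)| <= q * sum_a |phi(a, .)| |w(a^-1 g, .)|.
    The sum is the value at g of the convolution of the slice norms
    a |-> |phi(a, .)|, supported in E, and g |-> |w(g, .)|, whose l2 norms are
    those of phi and w; the bound on E then concludes. *)

Import Order.TTheory GRing.Theory Num.Theory.

Local Open Scope classical_set_scope.
Local Open Scope ring_scope.

(** Estimates are made on squared norms: they are plain sums of nonnegative terms in the extended
    reals, so they can be bounded and rearranged term by term. *)
Definition sqnorm {R : realType} {X : choiceType} (w : X -> R[i]) : \bar R :=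
  (\esum_(x in [set: X]) ((Normc.normc (w x)) ^+ 2)%:E)%E.

Lemma sqnorm_ge0 {R : realType} {X : choiceType} (w : X -> R[i]) :
  (0 <= sqnorm w)%E.
Proof. by apply: esum_ge0 => x _; rewrite lee_fin sqr_ge0. Qed.

Lemma sqr_l2norm {R : realType} {X : choiceType} (w : X -> R[i]) :
  (l2norm w ^+ 2)%E = sqnorm w.
Proof. exact: sqr_sqrte (sqnorm_ge0 w). Qed.

Lemma l2norm_ge0 {R : realType} {X : choiceType} (w : X -> R[i]) :
  (0 <= l2norm w)%E.
Proof. exact: sqrte_ge0. Qed.

Lemma sqnorm_fineK {R : realType} {X : choiceType} (w : X -> R[i]) :
  (sqnorm w < +oo)%E -> sqnorm w = ((Num.sqrt (fine (sqnorm w))) ^+ 2)%:E.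
Proof.
move=> woo; rewrite sqr_sqrtr ?fine_ge0 ?sqnorm_ge0// fineK//.
by rewrite ge0_fin_numE ?sqnorm_ge0.
Qed.

Lemma le_esumZ {R : realType} {X : choiceType} (k : R) (a : X -> \bar R) :
  0 <= k -> (forall x, 0 <= a x)%E ->
  (\esum_(x in [set: X]) (k%:E * a x) <= k%:E * \esum_(x in [set: X]) a x)%E.
Proof.
move=> k0 a0; apply: ge_ereal_sup => _ [A [finA _] <-].
rewrite -ge0_mule_fsumr//; apply: lee_wpmul2l; first by rewrite lee_fin.
by apply: ereal_sup_ubound; exists A => //; split.
Qed.

Lemma esum_ge_term {R : realType} {X : choiceType} (a : X -> \bar R) x :
  (a x <= \esum_(y in [set: X]) a y)%E.
Proof.
apply: esum_ge; exists [set x]; last by rewrite fsbig_set1.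
by split; first exact: finite_set1.
Qed.

Lemma sqnorm_eq0 {R : realType} {X : choiceType} (w : X -> R[i]) :
  (sqnorm w <= 0)%E -> w = fun=> 0.
Proof.
move=> w0; apply/funext => x; apply: Normc.eq0_normc; apply/eqP.
rewrite -sqrf_eq0 eq_le sqr_ge0 andbT -lee_fin.
exact: le_trans (esum_ge_term (fun x => (Normc.normc (w x) ^+ 2)%:E) x) w0.
Qed.

Lemma sqnorm0 {R : realType} {X : choiceType} :
  sqnorm (fun _ : X => 0 : R[i]) = 0%E.
Proof. by apply: esum1 => x _; rewrite Normc.normc0 expr0n. Qed.

Lemma normc_real {R : realType} (x : R) : Normc.normc (x%:C)%C = `|x|.
Proof. by rewrite /= expr0n addr0 sqrtr_sqr. Qed.

Lemma le_sqnormZ {R : realType} {X : choiceType} (k : R) (w : X -> R[i]) :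
  (sqnorm (fun x => (k%:C)%C * w x)%R <= (k ^+ 2)%:E * sqnorm w)%E.
Proof.
apply: le_trans (le_esumZ _ _ _ _); rewrite ?sqr_ge0//; last first.
  by move=> x; rewrite lee_fin sqr_ge0.
apply: le_esum => x _.
by rewrite Normc.normcM normc_real exprMn real_normK ?num_real// EFinM.
Qed.

(** Minkowski's inequality with bounds [c], [d] in place of the norms. A pointwise weighted AM-GM
    inequality is summed over [X]; its weights are chosen so that [(1 + d / c) * c ^+ 2 + (1 + c /
    d) * d ^+ 2] is exactly [(c + d) ^+ 2]. They require [c] and [d] positive; if one is zero, the
    corresponding function vanishes. *)
Lemma sqnormD {R : realType} {X : choiceType} (u v : X -> R[i]) (c d : R) :
  0 <= c -> 0 <= d -> (sqnorm u <= (c ^+ 2)%:E)%E ->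
  (sqnorm v <= (d ^+ 2)%:E)%E ->
  (sqnorm (fun x => u x + v x)%R <= ((c + d) ^+ 2)%:E)%E.
Proof.
rewrite le_eqVlt => /predU1P[<- _|c0].
  rewrite expr0n => /sqnorm_eq0 -> vd; rewrite add0r.
  by under [X in sqnorm X]funext => x do rewrite add0r.
rewrite le_eqVlt => /predU1P[<- ud|d0 uc vd].
  rewrite expr0n => /sqnorm_eq0 ->; rewrite addr0.
  by under [X in sqnorm X]funext => x do rewrite addr0.
(* AM-GM: [2 s t <= (d / c) s^2 + (c / d) t^2] *)
have amgm (s t : R) :
    (s + t) ^+ 2 <= (1 + d / c) * s ^+ 2 + (1 + c / d) * t ^+ 2.
  rewrite -subr_ge0 (_ : _ - _ = (d * s - c * t) ^+ 2 / (c * d)).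
    by rewrite divr_ge0 ?sqr_ge0// ltW// mulr_gt0.
  by field; rewrite !gt_eqF.
have k0 : 0 <= 1 + d / c by rewrite addr_ge0// ltW// divr_gt0.
have l0 : 0 <= 1 + c / d by rewrite addr_ge0// ltW// divr_gt0.
have -> : ((c + d) ^+ 2)%:E = ((1 + d / c)%:E * (c ^+ 2)%:E
    + (1 + c / d)%:E * (d ^+ 2)%:E)%E :> \bar R.
  by rewrite -!EFinM -EFinD; congr EFin; field; rewrite !gt_eqF.
apply: (@le_trans _ _ ((1 + d / c)%:E * sqnorm u + (1 + c / d)%:E * sqnorm v)%E);
  last by apply: leeD; apply: lee_wpmul2l; rewrite ?lee_fin.
apply: le_trans (leeD (le_esumZ _ _ k0 _) (le_esumZ _ _ l0 _)); first last.
- by move=> x; rewrite lee_fin sqr_ge0.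
- by move=> x; rewrite lee_fin sqr_ge0.
rewrite -esumD => [|x _|x _]; try by rewrite -EFinM lee_fin mulr_ge0 ?sqr_ge0.
apply: le_esum => x _; rewrite -!EFinM -EFinD lee_fin.
apply: le_trans (amgm _ _); rewrite ler_sqr ?nnegrE ?le_normcD//.
  by case: (_ + _) => a b; exact: sqrtr_ge0.
by apply: addr_ge0; [case: (u x)|case: (v x)] => a b; exact: sqrtr_ge0.
Qed.

Lemma sqnorm_sum {R : realType} {X : choiceType} {I : eqType} (s : seq I)
    (u : I -> X -> R[i]) (c : I -> R) :
  (forall i, 0 <= c i) -> (forall i, (sqnorm (u i) <= (c i ^+ 2)%:E)%E) ->
  (sqnorm (fun x => \sum_(i <- s) u i x)%R <= ((\sum_(i <- s) c i) ^+ 2)%:E)%E.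
Proof.
move=> c0 uc; elim: s => [|i s IHs].
  under [X in sqnorm X]funext => x do rewrite big_nil.
  by rewrite sqnorm0 lee_fin sqr_ge0.
under [X in sqnorm X]funext => x do rewrite big_cons.
by rewrite big_cons; apply: sqnormD => //; apply: sumr_ge0.
Qed.

(** Tonelli for a nonnegative double sum. *)
Lemma sqnorm_prod {R : realType} {X Y : choiceType} (w : X * Y -> R[i]) :
  sqnorm w = (\esum_(x in [set: X]) sqnorm (fun y => w (x, y)))%E.
Proof.
rewrite /sqnorm esum_esum => [|x y _ _]; last by rewrite lee_fin sqr_ge0.
rewrite (_ : _ `*`` _ = [set: X * Y]); first by apply: eq_esum => -[].
by apply/seteqP; split.
Qed.

(** Real-valued, so that it can serve as a coefficient. Since [fine] sends [+oo] to 0, this is the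
    l2 norm of the slice only when that norm is finite. *)
Definition slice_norm {R : realType} {X Y : choiceType} (w : X * Y -> R[i])
  (x : X) : R := Num.sqrt (fine (sqnorm (fun y => w (x, y)))).

Lemma slice_normE {R : realType} {X Y : choiceType} (w : X * Y -> R[i]) x :
  (sqnorm w < +oo)%E ->
  sqnorm (fun y => w (x, y)) = (slice_norm w x ^+ 2)%:E.
Proof.
move=> woo; apply: sqnorm_fineK; apply: le_lt_trans woo.
rewrite sqnorm_prod.
exact: (esum_ge_term (fun x => sqnorm (fun y => w (x, y)))).
Qed.

Lemma sqnorm_slice_norm {R : realType} {X Y : choiceType} (w : X * Y -> R[i]) :
  (sqnorm w < +oo)%E -> sqnorm (fun x => (slice_norm w x)%:C)%C = sqnorm w.
Proof.
move=> woo; rewrite [RHS]sqnorm_prod; apply: eq_esum => x _.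
by rewrite slice_normE// normc_real real_normK ?num_real.
Qed.

(** Added terms vanish. This lets the support be enlarged to a box, over which the sum can be
    iterated. *)
Lemma lambda_superset {R : realType} {G : groupType} (f : group_alg R G)
    (A : {fset G}) (w : G -> R[i]) g : (finsupp f `<=` A)%fset ->
  lambda f w g = \sum_(h <- A) f h * w (h^-1 * g)%g.
Proof.
move=> fA; apply: big_fset_incl => // x _ xf.
by rewrite fsfun_dflt// mul0r.
Qed.

(** The operator norm only tests the unit ball, so [w] is divided by its norm [c] and linearity
    restores the factor; when [c] is 0, [w] itself is 0. *)
Lemma lambda_sqnorm {R : realType} {G : groupType} (f : group_alg R G)
    (q a c : R) (w : G -> R[i]) :
  (opnorm (lambda f) <= q%:E * l2norm f)%E -> 0 <= a -> 0 <= c ->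
  sqnorm f = (a ^+ 2)%:E -> sqnorm w = (c ^+ 2)%:E ->
  (sqnorm (lambda f w) <= ((q * a * c) ^+ 2)%:E)%E.
Proof.
move=> opf a0 c0 fa; move: c0; rewrite le_eqVlt => /predU1P[<-|c0 wc].
  rewrite expr0n => w0; rewrite (sqnorm_eq0 w) ?w0//.
  rewrite (_ : lambda f _ = fun=> 0); first by rewrite sqnorm0 lee_fin sqr_ge0.
  by apply/funext => g; rewrite /lambda big1// => h _; rewrite mulr0.
pose v x := ((c^-1)%:C * w x)%C.
have v1 : (sqnorm v <= 1)%E.
  apply: (le_trans (le_sqnormZ _ _)).
  by rewrite wc -EFinM exprVn mulVf// expf_neq0 ?gt_eqF.
have wE : w = fun x => (c%:C)%C * v x.
  by apply/funext => x; rewrite /v mulrA -rmorphM divff ?gt_eqF// mul1r.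
have lv1 : (l2norm v <= 1)%E.
  by apply: lee_sqrE => //; rewrite sqr_l2norm expe2 mule1.
have lwE : lambda f w = fun g => (c%:C)%C * lambda f v g.
  apply/funext => g; rewrite /lambda mulr_sumr; apply: eq_bigr => h _.
  by rewrite wE mulrCA.
have lv : (l2norm (lambda f v) <= (q * a)%:E)%E.
  apply: (@le_trans _ _ (opnorm (lambda f))).
    apply: ereal_sup_ubound; exists v => //; split=> //.
    exact: le_lt_trans lv1 (ltry _).
  apply: (le_trans opf).
  by rewrite /l2norm -/(sqnorm f) fa /= sqrtr_sqr ger0_norm// EFinM.
rewrite lwE; apply: (le_trans (le_sqnormZ _ _)).
rewrite exprMn mulrC [leRHS]EFinM; apply: lee_wpmul2l; first by rewrite lee_fin sqr_ge0.
rewrite -sqr_l2norm EFin_expe lee_sqr ?l2norm_ge0//.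
exact: le_trans (l2norm_ge0 _) lv.
Qed.

(** Restricting to [B] makes the support visibly finite; nothing is lost once [B] contains the
    second coordinates of the support of [phi]. *)
Definition slice {R : realType} {G H : groupType}
    (phi : group_alg R (G * H)%type) (B : {fset H}) (a : G) : group_alg R H :=
  [fsfun b in B => phi (a, b)].

Lemma lambda_prod {R : realType} {G H : groupType}
    (phi : group_alg R (G * H)%type) (A : {fset G}) (B : {fset H})
    (w : G * H -> R[i]) g h : (finsupp phi `<=` A `*` B)%fset ->
  lambda phi w (g, h) =
  \sum_(a <- A) lambda (slice phi B a) (fun y => w ((a^-1 * g)%g, y)) h.
Proof.
move=> phiAB; rewrite (lambda_superset _ _ _ _ phiAB) big_imfset2/=; last first.
  by move=> [a b] [a' b'] _ _ [/= -> ->].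
apply: eq_bigr => a _; rewrite (lambda_superset _ B) ?finsupp_sub//.
by apply: eq_big_seq => b bB; rewrite fsfun_fun bB.
Qed.

Theorem lemma1 (R : realType) (G H : groupType) (p q : R)
    (E : set G) (F : set H) (p_gt0 : 0 < p) (q_gt0 : 0 < q)
    (hE : forall f : group_alg R G, supp f `<=` E ->
       (opnorm (lambda f) <= p%:E * l2norm f)%E)
    (hF : forall f : group_alg R H, supp f `<=` F ->
       (opnorm (lambda f) <= q%:E * l2norm f)%E) :
  forall phi : group_alg R (G * H)%type, supp phi `<=` E `*` F ->
    (opnorm (lambda phi) <= (p * q)%:E * l2norm phi)%E.
Proof.
move=> phi phiEF; have pq0 : 0 < p * q by rewrite mulr_gt0.
(* If the norm of [phi] were infinite, so would be the right-hand side, as [p * q] is positive. *)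
have [phioo|] := eqVneq (sqnorm phi) +oo%E.
  by rewrite /l2norm -/(sqnorm phi) phioo /= gt0_muley ?lte_fin// leey.
rewrite -ltey => phioo; apply: ge_ereal_sup => _ [w [woo w1] <-].
apply: lee_sqrE; first by rewrite mule_ge0 ?l2norm_ge0// lee_fin ltW.
rewrite sqr_l2norm expe2 muleACA -!expe2 sqr_l2norm -EFin_expe.
have {woo}w1 : (sqnorm w <= 1)%E.
  by rewrite -sqr_l2norm -[1%E]mule1 -expe2 lee_sqr ?l2norm_ge0.
have woo : (sqnorm w < +oo)%E by apply: le_lt_trans w1 (ltry _).
pose A := [fset x.1 | x in finsupp phi]%fset.
pose B := [fset x.2 | x in finsupp phi]%fset.
have phiAB : (finsupp phi `<=` A `*` B)%fset.
  apply/fsubsetP => x xphi; rewrite in_fsetM.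
  by apply/andP; split; apply/imfsetP; exists x.
have sliceE a : slice phi B a =1 fun b => phi (a, b).
  move=> b; rewrite fsfun_fun; case: ifPn => // bB; rewrite fsfun_dflt//.
  by apply: contra bB => /(fsubsetP phiAB); rewrite in_fsetM => /andP[].
have sliceF a : supp (slice phi B a) `<=` F.
  move=> b; rewrite /supp/= mem_finsupp sliceE -mem_finsupp => ab.
  by have [] := phiEF (a, b) ab.
(* The default value 0 outside [A] is the correct one, because the slices of [phi] there are
   zero. *)
pose f : group_alg R G := [fsfun a in A => (slice_norm phi a)%:C%C].
have fE a : f a = (slice_norm phi a)%:C%C.
  rewrite fsfun_fun; case: ifPn => // aA; rewrite /slice_norm.
  rewrite (_ : (fun y => _) = fun=> 0) ?sqnorm0 ?sqrtr0//.
  apply/funext => b; rewrite fsfun_dflt//.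
  by apply: contra aA => /(fsubsetP phiAB); rewrite in_fsetM => /andP[].
have fsuppE : supp f `<=` E.
  move=> a; rewrite /supp/= => af.
  have : a \in A by apply: (fsubsetP (finsupp_sub _ _ _)) af.
  by move=> /imfsetP[[x y] /= xy ->]; have [] := phiEF _ xy.
pose W (g : G) := (slice_norm w g)%:C%C.
have snorm (X Y : choiceType) (u : X * Y -> R[i]) x : 0 <= slice_norm u x.
  exact: sqrtr_ge0.
(* Minkowski over [a], where the term at [a] has norm at most [q * slice_norm phi a * slice_norm w
   (a^-1 * g)] by the bound on [F]. Apart from [q], these bounds add up to [lambda f W g]. *)
have step g : (sqnorm (fun h => lambda phi w (g, h)) <=
    (q ^+ 2)%:E * (Normc.normc (lambda f W g) ^+ 2)%:E)%E.
  have -> : lambda f W g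
      = (\sum_(a <- A) slice_norm phi a * slice_norm w (a^-1 * g)%g)%:C%C.
    rewrite (lambda_superset _ A) ?finsupp_sub// rmorph_sum.
    by apply: eq_bigr => a _; rewrite fE rmorphM.
  rewrite normc_real real_normK ?num_real// -EFinM -exprMn mulr_sumr.
  under [X in sqnorm X]funext => h do rewrite (lambda_prod _ _ _ _ _ _ phiAB).
  apply: sqnorm_sum => a; first by rewrite !mulr_ge0// ltW.
  rewrite mulrA; apply: lambda_sqnorm => //.
  - exact: hF.
  - by rewrite -slice_normE//; congr sqnorm; apply/funext => b; rewrite sliceE.
  - by rewrite slice_normE.
have fphi : sqnorm f = sqnorm phi.
  by rewrite -(sqnorm_slice_norm phi)//; congr sqnorm; apply/funext => a.
(* The bound on [E] for [f] and [W], whose norms are those of [phi] and [w]; the latter is at most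
   1. *)
have pstep : (sqnorm (lambda f W) <= (p ^+ 2)%:E * sqnorm phi)%E.
  have Woo : (sqnorm W < +oo)%E by rewrite sqnorm_slice_norm.
  have foo : (sqnorm f < +oo)%E by rewrite fphi.
  apply: le_trans (lambda_sqnorm _ _ _ _ _ (hE _ fsuppE) _ _
    (sqnorm_fineK _ foo) (sqnorm_fineK _ Woo)) _; rewrite ?sqrtr_ge0//.
  rewrite !exprMn EFinM EFinM -!sqnorm_fineK// fphi sqnorm_slice_norm//.
  rewrite -[leRHS]mule1; apply: lee_wpmul2l => //.
  by rewrite mule_ge0 ?sqnorm_ge0// lee_fin sqr_ge0.
(* Summing the squared slice estimates over [g] gives the factor [q ^+ 2], and [pstep] supplies the
   rest. *)
rewrite sqnorm_prod; apply: (le_trans (le_esum (fun g _ => step g))).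
apply: le_trans (le_esumZ _ _ _ _) _; rewrite ?sqr_ge0//.
  by move=> x; rewrite lee_fin sqr_ge0.
rewrite exprMn mulrC [in leRHS]EFinM -muleA; apply: lee_wpmul2l => //.
by rewrite lee_fin sqr_ge0.
Qed.
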